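(* Let $L$ be a non-abelian finite-dimensional Lie algebra over a finite field $\mathbb{F}_q$, and let $G_L$ be its non-commuting graph. Then $G_L$ is outerplanar if and only if $G_L$ is isomorphic to the complete graph $K_3$.
   Context: $\mathbb{F}_q$ denotes the finite field with $q$ elements. For a Lie algebra $L$, $Z(L)=\{x\in L : [x,y]=0 \text{ for all } y\in L\}$ is its centre. The non-commuting graph $G_L$ is the undirected simple graph with vertex set $L\setminus Z(L)$, in which two distinct vertices $x$ and $y$ are adjacent if and only if $[x,y]\neq 0$. A graph is outerplanar if it can be embedded in the plane so that all its vertices lie on the outer face. *)

(* Defs.v *)
From HB Require Import structures.
From mathcomp Require Import all_boot all_order all_algebra all_field.
From mathcomp Require Import all_classical all_reals all_analysis.

Set Implicit Arguments.
Unset Strict Implicit.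
Unset Printing Implicit Defensive.

Import Order.TTheory GRing.Theory Num.Theory.
Import numFieldNormedType.Exports.

Local Open Scope classical_set_scope.
Local Open Scope ring_scope.

HB.mixin Record Lmodule_isLieAlgebra (F : fieldType) (L : Type)
    of GRing.Lmodule F L := {
  lie : L -> L -> L;
  lie_linearl : forall y, linear (fun x => lie x y);
  lie_linearr : forall x, linear (lie x);
  liexx : forall x, lie x x = 0;
  lie_jacobi : forall x y z,
    lie x (lie y z) + lie y (lie z x) + lie z (lie x y) = 0
}.

#[short(type="lieAlgType")]
HB.structure Definition LieAlgebra (F : fieldType) :=
  { L of Lmodule_isLieAlgebra F L & GRing.Lmodule F L }.

#[short(type="finDimLieAlgType")]
HB.structure Definition FinDimLieAlgebra (F : fieldType) :=
  { L of LieAlgebra F L & Vector F L }.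

Definition lie_abelian (F : fieldType) (L : lieAlgType F) : Prop :=
  forall x y : L, lie x y = 0.

(* A vector space over a finite field is finite, but only its alias
   [finvect_type L] carries the canonical [finType] structure. *)
Definition lie_center (F : finFieldType) (L : finDimLieAlgType F) :
    {set finvect_type L} :=
  [set x : finvect_type L | [forall y : finvect_type L, lie (x : L) y == 0]]%SET.

Record sgraph := SGraph {
  vertex :> finType;
  adj : rel vertex;
  adj_sym : symmetric adj;
  adj_irrefl : irreflexive adj
}.

Definition graph_iso (G H : sgraph) : Prop :=
  exists2 h : G -> H, bijective h & forall x y, adj (h x) (h y) = adj x y.

Section CompleteGraph.
Variable n : nat.

Definition complete_adj : rel 'I_n := fun i j => i != j.

Lemma complete_adj_sym : symmetric complete_adj.
Proof. by move=> i j; rewrite /complete_adj eq_sym. Qed.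

Lemma complete_adj_irrefl : irreflexive complete_adj.
Proof. by move=> i; rewrite /complete_adj eqxx. Qed.

Definition complete_graph : sgraph :=
  SGraph complete_adj_sym complete_adj_irrefl.
End CompleteGraph.

Section NonCommutingGraph.
Variables (F : finFieldType) (L : finDimLieAlgType F).

Definition noncentral : finType := {x : finvect_type L | x \notin lie_center L}.

Definition noncommuting : rel noncentral :=
  fun x y => (x != y) && (lie (val x : L) (val y) != 0).

Lemma lie_anticomm (x y : L) : lie x y = - lie y x.
Proof.
have addl u v z : lie (u + v) z = lie u z + lie v z :> L.
  by have := lie_linearl z 1 u v; rewrite !scale1r.
have addr u v z : lie z (u + v) = lie z u + lie z v :> L.
  by have := lie_linearr z 1 u v; rewrite !scale1r.
apply/eqP; rewrite -addr_eq0; apply/eqP.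
by have := liexx (x + y); rewrite addl !addr !liexx add0r addr0.
Qed.

Lemma noncommuting_sym : symmetric noncommuting.
Proof.
by move=> x y; rewrite /noncommuting eq_sym lie_anticomm oppr_eq0.
Qed.

Lemma noncommuting_irrefl : irreflexive noncommuting.
Proof. by move=> x; rewrite /noncommuting eqxx. Qed.

Definition noncommuting_graph : sgraph :=
  SGraph noncommuting_sym noncommuting_irrefl.
End NonCommutingGraph.

Section Outerplanar.
Variable R : realType.
Local Notation plane := (R * R)%type.

(* [A] is a (not necessarily polygonal) simple arc with endpoints [a] and [b];
   its interior is [A `\` [set a; b]]. *)
Definition is_arc (a b : plane) (A : set plane) : Prop :=
  exists f : R -> plane,
    [/\ {within `[0, 1], continuous f},
        {in `[0, 1] &, injective f},
        f 0 = a, f 1 = b & f @` `[0, 1] = A].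

Variable G : sgraph.
Implicit Types (p : G -> plane) (arc : G -> G -> set plane).

(* The values of [arc] on non-adjacent pairs are irrelevant. *)
Definition plane_embedding p arc : Prop :=
  [/\ injective p,
      forall u v, adj u v -> is_arc (p u) (p v) (arc u v),
      forall u v, adj u v -> arc u v = arc v u,
      forall u v w, adj u v -> ~ (arc u v `\` [set p u; p v]) (p w) &
      forall u v u' v', adj u v -> adj u' v' ->
        [set u; v]%SET != [set u'; v']%SET ->
        (arc u v `\` [set p u; p v]) `&` (arc u' v' `\` [set p u'; p v'])
          = set0].

Definition drawing p arc : set plane :=
  range p `|` [set z | exists u v, adj u v /\ arc u v z].

Definition is_face p arc (U : set plane) : Prop :=
  exists2 z, (~` drawing p arc) z & U = connected_component (~` drawing p arc) z.

(* The drawing is compact, so exactly one face is unbounded. *)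
Definition is_outer_face p arc (U : set plane) : Prop :=
  is_face p arc U /\ ~ bounded_set U.

(* Faces are disjoint from the drawing, so a vertex lies on the boundary of a
   face iff it is in its closure. *)
Definition outerplanar : Prop :=
  exists p arc, plane_embedding p arc /\
    exists2 U, is_outer_face p arc U & forall v : G, closure U (p v).
End Outerplanar.

(* Main.v *)
Require Import Defs.
From HB Require Import structures.
From mathcomp Require Import all_boot all_order all_algebra all_field.
From mathcomp Require Import all_classical all_reals all_analysis.
From mathcomp Require Import ring lra.
From Stdlib Require Import Btauto.

(** The triangle is clearly outerplanar; the content is that an outerplanar
    noncommuting graph is a triangle.  This combines two facts: outerplanar graphs
    contain no K_{2,3}, and every other nonempty noncommuting graph contains one.

    Outerplanar graphs contain no K_{2,3} ([outerplanar_no_K23]).  A point of the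
    outer face, joined through this face to the three vertices on the small side,
    would extend the drawing to a drawing of K_{3,3}.  Nonplanarity of K_{3,3} is
    obtained from the van Kampen parity argument, without the Jordan curve theorem.
    For two disjoint polygonal lines, count modulo 2 the edges of each that lie
    above the endpoints of the other; the sum of these counts only depends on the
    left-to-right order of the four endpoints ([disjoint_polygons_parity]).  Adding
    these equations over the 18 pairs of independent edges of K_{3,3} gives 0 = 1
    ([K33_parity]).  Adjacent edges do not enter, so the edges may be replaced by
    polygonal approximations fine enough to keep independent edges disjoint; the
    edges can therefore be arbitrary compact connected sets ([no_K33_continua]),
    which deals with wild arcs and with the possibly complicated access to a vertex
    from the outer face ([closure_joined]).

    On the Lie algebra side, if [u] and [v] are distinct, commute, and [t] commutes
    with neither, then [u], [v] and [t], [t + u], [t + v] form a K_{2,3}.  Two proper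
    centralizers never cover the algebra, so in the absence of K_{2,3} distinct
    noncentral elements never commute ([noncentral_lie_neq0]).  Comparing [x] with
    its multiples shows that the field has two elements.  If [x] and [y] do not
    commute, a noncentral [w] other than [x], [y] and [x + y] would give five
    pairwise adjacent vertices [x], [y], [x + y], [w], [w + x], hence a K_{2,3}
    ([noncentral_in]).  So the graph is the triangle on [x], [y], [x + y]. *)

Set Implicit Arguments.
Unset Strict Implicit.
Unset Printing Implicit Defensive.

Import Order.TTheory GRing.Theory Num.Theory.
Import numFieldNormedType.Exports.

Local Open Scope classical_set_scope.
Local Open Scope ring_scope.

(** * Crossing parity of plane polygonal lines *)

(** [btauto] knows [xorb] only. *)
Lemma addbE (a b : bool) : a (+) b = xorb a b.
Proof. by case: a b => [] []. Qed.

Section Polygons.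
Variable R : realFieldType.
Local Notation pt := (R * R)%type.
Implicit Types (a b c d u v x y z : pt).

Definition seg_point a b (t : R) : pt :=
  ((1 - t) * a.1 + t * b.1, (1 - t) * a.2 + t * b.2).

Definition on_segment a b z := exists2 t : R, 0 <= t <= 1 & z = seg_point a b t.

Definition segments_disjoint a b c d :=
  forall z, on_segment a b z -> ~ on_segment c d z.

(** Twice the signed area of the triangle [a b c]: positive iff it is
    counterclockwise. *)
Definition turn a b c := (b.1 - a.1) * (c.2 - a.2) - (b.2 - a.2) * (c.1 - a.1).

(** Whether the upward vertical ray from [c] meets the segment [a b], once
    verticality ties have been resolved by a horizontal order [lt].  With the
    lexicographic order this amounts to tilting the ray infinitesimally, so that
    it passes through no endpoint other than [c]. *)
Definition ray_hits (lt : rel pt) a b c :=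
  [|| [&& lt a c, lt c b & turn a b c < 0] | [&& lt b c, lt c a & 0 < turn a b c]].

Definition before1 : rel pt := fun u v => u.1 < v.1.

Definition before : rel pt :=
  fun u v => (u.1 < v.1) || (u.1 == v.1) && (u.2 < v.2).

Lemma on_segmentl a b : on_segment a b a.
Proof.
exists 0; first by rewrite lexx ler01.
by case: a => ? ?; rewrite /seg_point /=; congr pair; ring.
Qed.

Lemma on_segmentr a b : on_segment a b b.
Proof.
exists 1; first by rewrite lexx ler01.
by case: b => ? ?; rewrite /seg_point /=; congr pair; ring.
Qed.

Lemma on_segmentC a b z : on_segment a b z -> on_segment b a z.
Proof.
case=> t /andP[t0 t1] ->; exists (1 - t); first by apply/andP; split; lra.
by rewrite /seg_point; congr pair; ring.
Qed.

Lemma segments_disjointCl a b c d :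
  segments_disjoint a b c d -> segments_disjoint b a c d.
Proof. by move=> D z /on_segmentC; apply: D. Qed.

Lemma segments_disjointCr a b c d :
  segments_disjoint a b c d -> segments_disjoint a b d c.
Proof. by move=> D z abz /on_segmentC; apply: D. Qed.

Lemma segments_disjointC a b c d :
  segments_disjoint a b c d -> segments_disjoint c d a b.
Proof. by move=> D z cdz abz; apply: (D z). Qed.

Lemma turnC a b c : turn b a c = - turn a b c.
Proof. by rewrite /turn; ring. Qed.

Lemma ray_hitsC lt a b c : ray_hits lt b a c = ray_hits lt a b c.
Proof. by rewrite /ray_hits turnC oppr_lt0 oppr_gt0 orbC. Qed.

Lemma on_segment_trans c d e z :
  on_segment c d e -> on_segment c e z -> on_segment c d z.
Proof.
case=> t /andP[t0 t1] -> [r /andP[r0 r1] ->]; exists (r * t).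
  by rewrite mulr_ge0 //= mulr_ile1.
by rewrite /seg_point /=; congr pair; ring.
Qed.

Lemma affine_zero (p q : R) : p * q <= 0 ->
  exists2 r : R, 0 <= r <= 1 & (1 - r) * p + r * q = 0.
Proof.
move=> pq; have [p0|p0] := eqVneq p 0.
  by exists 0; rewrite ?lexx ?ler01 // p0; ring.
have p2 : 0 < p * p by rewrite -expr2 exprn_even_gt0.
have d0 : 0 < p * p - p * q by lra.
exists ((p * p) / (p * p - p * q)); last first.
  by field; rewrite gt_eqF //=.
by rewrite divr_ge0 ?(ltW p2) ?(ltW d0) //= ler_pdivrMr // mul1r; lra.
Qed.

(** The zero of [turn a b] on [c e] lies on the line [a b]; being within the
    vertical strip over [a b], it lies on the segment. *)
Lemma segments_meet a b c e : a.1 < b.1 ->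
  a.1 <= c.1 <= b.1 -> a.1 <= e.1 <= b.1 -> turn a b c * turn a b e <= 0 ->
  exists2 z, on_segment a b z & on_segment c e z.
Proof.
move=> ab /andP[ac cb] /andP[ae eb] /affine_zero[r /andP[r0 r1] Tr].
exists (seg_point c e r); last by exists r => //; rewrite r0.
have ba0 : b.1 - a.1 != 0 by rewrite subr_eq0 gt_eqF.
exists (((1 - r) * c.1 + r * e.1 - a.1) / (b.1 - a.1)).
  rewrite ler_pdivrMr ?subr_gt0 // ler_pdivlMr ?subr_gt0 // mul0r mul1r.
  by apply/andP; split; nra.
rewrite /seg_point; congr pair; first by field.
move: Tr; rewrite /turn => Tr.
apply: (mulfI ba0); apply/eqP; rewrite -subr_eq0; apply/eqP.
rewrite -[RHS]Tr; field; exact: ba0.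
Qed.

(** The parity of crossings of two segments that do not cross, read off from
    their endpoints.  After ordering the endpoints by abscissa, three positions
    remain.  If the two shadows on the horizontal axis are disjoint, no ray hits
    anything.  If one shadow contains the other, the inner segment is entirely
    above or entirely below the outer one.  If they overlap partially, exactly one
    of the two inner endpoints is below the other segment. *)
Lemma disjoint_segments_parity1 a b c d :
    a.1 != c.1 -> a.1 != d.1 -> b.1 != c.1 -> b.1 != d.1 ->
    segments_disjoint a b c d ->
  ray_hits before1 a b c (+) ray_hits before1 a b d
    (+) ray_hits before1 c d a (+) ray_hits before1 c d b =
  before1 a c (+) before1 a d (+) before1 b c (+) before1 b d.
Proof.
wlog ab : a b / a.1 <= b.1.
  move=> H ac ad bc bd D; case/orP: (le_total a.1 b.1) => ab; first exact: H.
  have := H b a ab bc bd ac ad (segments_disjointCl D).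
  rewrite !(ray_hitsC _ b a).
  by do 4![case: ray_hits]; do 4![case: before1].
wlog cd : c d / c.1 <= d.1.
  move=> H ac ad bc bd D; case/orP: (le_total c.1 d.1) => cd; first exact: H.
  have := H d c cd ad ac bd bc (segments_disjointCr D).
  rewrite !(ray_hitsC _ d c).
  by do 4![case: ray_hits]; do 4![case: before1].
wlog ac : a b c d ab cd / a.1 < c.1.
  move=> H nac nad nbc nbd D; have [ac|ca|e] := ltgtP a.1 c.1; first exact: H.
    have := H c d a b cd ab ca.
    rewrite eq_sym in nac; rewrite eq_sym in nad.
    rewrite eq_sym in nbc; rewrite eq_sym in nbd.
    move=> /(_ nac nbc nad nbd (segments_disjointC D)).
    have before1N u v : u.1 != v.1 -> before1 u v = ~~ before1 v u.
      by rewrite /before1 -leNgt lt_neqAle => ->.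
    rewrite (before1N c a) // (before1N c b) // (before1N d a) // (before1N d b) //.
    by do 4![case: ray_hits]; do 4![case: before1].
  by rewrite e eqxx in nac.
move=> _ nad nbc nbd D.
have ad : a.1 < d.1 := lt_le_trans ac cd.
have [bc|cb] := boolP (b.1 < c.1).
  have bd : b.1 < d.1 := lt_le_trans bc cd.
  rewrite /ray_hits /before1 ac ad bc bd (lt_gtF ac) (lt_gtF ad) (lt_gtF bc).
  by rewrite (lt_gtF bd) ?andbF.
have {nbc}cb : c.1 < b.1 by rewrite -leNgt le_eqVlt eq_sym (negPf nbc) in cb.
have ab' := lt_trans ac cb.
rewrite /ray_hits /before1 ac ad cb (lt_gtF ac) (lt_gtF ad) (lt_gtF cb).
rewrite /= !orbF.
have [bd|] := ltP b.1 d.1.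
  rewrite (lt_gtF bd) /= orbF addbF.
  apply/negPn/negP => E.
  have dc0 : d.1 - c.1 != 0 by rewrite subr_eq0 gt_eqF // (lt_trans cb).
  (* the point of [c d] on the vertical line through [b] *)
  pose r := (b.1 - c.1) / (d.1 - c.1).
  have cr : on_segment c d (seg_point c d r).
    exists r => //; rewrite /r.
    rewrite ler_pdivrMr ?subr_gt0 // ?ler_pdivlMr ?subr_gt0 ?(lt_trans cb) //.
    rewrite mul0r mul1r.
    by apply/andP; split; lra.
  have r1 : (seg_point c d r).1 = b.1 by rewrite /seg_point /r /=; field.
  have r2 : (d.1 - c.1) * turn a b (seg_point c d r) = - (b.1 - a.1) * turn c d b.
    by rewrite /turn r1 /seg_point /r /=; field.
  have [] := @segments_meet a b c (seg_point c d r) ab'.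
  - by rewrite !ltW.
  - by rewrite r1 lexx ltW.
  - have dc : 0 < d.1 - c.1 by lra.
    have ba : 0 < b.1 - a.1 by lra.
    rewrite -(pmulr_lle0 _ dc) -mulrA [_ * (_ - _)]mulrC r2 mulrCA mulNr oppr_le0.
    apply: mulr_ge0; first exact: ltW.
    move: E; have [lt1|ge1] := ltP (turn a b c) 0;
      have [lt2|ge2] := ltP (turn c d b) 0 => //= _.
      by rewrite mulr_le0 ?ltW.
    by rewrite mulr_ge0.
  by move=> z z1 z2; case: (D z z1); apply: (on_segment_trans cr).
rewrite le_eqVlt eq_sym (negPf nbd) /= => db.
rewrite db /= !addbF.
apply/negbTE/negP => E.
have [] := @segments_meet a b c d ab'.
- by rewrite !ltW.
- by rewrite !ltW.
- move: E; have [lt1|ge1] := ltP (turn a b c) 0;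
    have [lt2|ge2] := ltP (turn a b d) 0 => //= _.
    by rewrite mulr_le0_ge0 // ltW.
  by rewrite mulr_ge0_le0 // ltW.
by move=> z z1 z2; case: (D z z1).
Qed.

(** Shearing preserves [turn] and incidence, and a small shear replaces
    lexicographic comparisons by comparisons of abscissas.  This reduces degenerate
    positions to the case of distinct abscissas. *)
Definition shear (e : R) u : pt := (u.1 + e * u.2, u.2).

Lemma turn_shear e a b c : turn (shear e a) (shear e b) (shear e c) = turn a b c.
Proof. by rewrite /turn /shear /=; ring. Qed.

Lemma on_segment_shear e a b z :
  on_segment (shear e a) (shear e b) z -> on_segment a b (shear (- e) z).
Proof.
case=> t t01 ->; exists t => //.
by rewrite /shear /seg_point /=; congr pair; ring.
Qed.

Lemma segments_disjoint_shear e a b c d : segments_disjoint a b c d ->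
  segments_disjoint (shear e a) (shear e b) (shear e c) (shear e d).
Proof.
by move=> D z /on_segment_shear abz /on_segment_shear; apply: D.
Qed.

Lemma shear_before u v : exists2 e0 : R, 0 < e0 &
  forall e, 0 < e < e0 -> before1 (shear e u) (shear e v) = before u v.
Proof.
rewrite /before /before1 /shear /=.
have [uv|vu|->] := ltgtP u.1 v.1; last first.
- by exists 1 => // e /andP[e0 _]; rewrite ltrD2l ltr_pM2l.
- (* the summand 1 keeps the denominator positive *)
  exists ((u.1 - v.1) / (1 + `|v.2 - u.2|)); first
    by rewrite divr_gt0 //; have := normr_ge0 (v.2 - u.2); lra.
  move=> e /andP[e0]; rewrite ltr_pdivlMr; last by have := normr_ge0 (v.2 - u.2); lra.
  move=> he; apply/negbTE; rewrite -leNgt.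
  have : e * (v.2 - u.2) <= e * `|v.2 - u.2| by rewrite ler_pM2l // ler_norm.
  by lra.
- exists ((v.1 - u.1) / (1 + `|u.2 - v.2|)); first
    by rewrite divr_gt0 //; have := normr_ge0 (u.2 - v.2); lra.
  move=> e /andP[e0]; rewrite ltr_pdivlMr; last by have := normr_ge0 (u.2 - v.2); lra.
  move=> he.
  have : e * (u.2 - v.2) <= e * `|u.2 - v.2| by rewrite ler_pM2l // ler_norm.
  by lra.
Qed.

Lemma shear_before_all (s : seq pt) : exists2 e : R, 0 < e &
  {in s &, forall u v, before1 (shear e u) (shear e v) = before u v}.
Proof.
suff [e0 e0_gt0 H] : exists2 e0 : R, 0 < e0 & forall e, 0 < e < e0 ->
    {in [seq (u, v) | u <- s, v <- s],
     forall w, before1 (shear e w.1) (shear e w.2) = before w.1 w.2}.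
  exists (e0 / 2); first by rewrite divr_gt0.
  move=> u v us vs; apply: (H _ _ (u, v)); last exact: allpairs_f.
  by apply/andP; split; lra.
move: [seq _ | u <- s, v <- s]; elim=> [|w l [e1 e1_gt0 H1]]; first by exists 1.
have [e2 e2_gt0 H2] := shear_before w.1 w.2.
exists (Num.min e1 e2); first by rewrite lt_min e1_gt0.
move=> e /andP[e_gt0]; rewrite lt_min => /andP[ee1 ee2] w'.
rewrite inE => /predU1P[->|]; first by apply: H2; rewrite e_gt0.
by apply: H1; rewrite e_gt0.
Qed.

Lemma before_total u v : u != v -> before u v = ~~ before v u.
Proof.
case: u v => [u1 u2] [v1 v2]; rewrite /before /= => uv.
have [||e] := ltgtP u1 v1 => //=.
by move: uv; rewrite e -leNgt lt_neqAle xpair_eqE eqxx /= => ->.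
Qed.

Lemma disjoint_segments_parity a b c d : segments_disjoint a b c d ->
  ray_hits before a b c (+) ray_hits before a b d
    (+) ray_hits before c d a (+) ray_hits before c d b =
  before a c (+) before a d (+) before b c (+) before b d.
Proof.
move=> D; have [e e_gt0 He] := shear_before_all [:: a; b; c; d].
have He' u v : u \in [:: a; b; c; d] -> v \in [:: a; b; c; d] ->
    before1 (shear e u) (shear e v) = before u v by exact: He.
have in4 : (a \in [:: a; b; c; d]) * (b \in [:: a; b; c; d])
    * (c \in [:: a; b; c; d]) * (d \in [:: a; b; c; d]).
  by rewrite !inE !eqxx !orbT.
have ray_hits_shear u v w :
    u \in [:: a; b; c; d] -> v \in [:: a; b; c; d] -> w \in [:: a; b; c; d] ->
    ray_hits before1 (shear e u) (shear e v) (shear e w) = ray_hits before u v w.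
  by move=> us vs ws; rewrite /ray_hits turn_shear !He'.
have neq1 u v : u != v -> u \in [:: a; b; c; d] -> v \in [:: a; b; c; d] ->
    (shear e u).1 != (shear e v).1.
  move=> /before_total uv us vs; apply/eqP => E.
  have := He' _ _ us vs; have := He' _ _ vs us.
  by rewrite /before1 E ltxx uv => <-.
have ac : a != c.
  by apply: contraPneq (D a (on_segmentl a b)) => ->; apply; exact: on_segmentl.
have ad : a != d.
  by apply: contraPneq (D a (on_segmentl a b)) => ->; apply; exact: on_segmentr.
have bc : b != c.
  by apply: contraPneq (D b (on_segmentr a b)) => ->; apply; exact: on_segmentl.
have bd : b != d.
  by apply: contraPneq (D b (on_segmentr a b)) => ->; apply; exact: on_segmentr.
rewrite -!ray_hits_shear ?in4 // -!He' ?in4 //.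
apply: disjoint_segments_parity1; try by apply: neq1; rewrite ?in4.
exact: segments_disjoint_shear.
Qed.

Fixpoint ray_parity x (s : seq pt) v : bool :=
  if s is y :: s' then ray_hits before x y v (+) ray_parity y s' v else false.

(** Addition of two equations over the field with two elements. *)
Lemma xor_cancel (l r l1 r1 l2 r2 : bool) : l1 = r1 -> l2 = r2 ->
  xorb (xorb l1 r1) (xorb l2 r2) = xorb l r -> l = r.
Proof. by move=> -> ->; case: r1 r2 l r => [] [] [] []. Qed.

(** Sum of [disjoint_segments_parity] over all pairs of edges: in each of the
    eight terms the contributions of interior vertices cancel.  The relations [P]
    and [Q] are the constraints under which the edges of the two lines are known to
    be disjoint. *)
Lemma disjoint_polygons_parity (P Q : rel pt) x s y t :
    (forall a b c d, P a b -> Q c d -> segments_disjoint a b c d) ->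
    path P x s -> path Q y t ->
  ray_parity x s y (+) ray_parity x s (last y t)
    (+) ray_parity y t x (+) ray_parity y t (last x s) =
  before x y (+) before x (last y t)
    (+) before (last x s) y (+) before (last x s) (last y t).
Proof.
move=> PQ.
have single a b c (u : seq pt) : P a b -> path Q c u ->
    ray_hits before a b c (+) ray_hits before a b (last c u)
      (+) ray_parity c u a (+) ray_parity c u b =
    before a c (+) before a (last c u) (+) before b c (+) before b (last c u).
  move=> Pab; elim: u c => [|d u IH] c /=.
    by move=> _; rewrite !addbE; btauto.
  case/andP=> Qcd /IH IHu.
  apply: (xor_cancel (disjoint_segments_parity (PQ _ _ _ _ Pab Qcd)) IHu).
  by rewrite !addbE; btauto.
elim: s x => [|b s IH] x /=.
  by move=> _ _; rewrite !addbE; btauto.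
case/andP=> Pxb Ps Qt; apply: (xor_cancel (single _ _ _ _ Pxb Qt) (IH _ Ps Qt)).
by rewrite !addbE; btauto.
Qed.

(** The van Kampen obstruction of K_{3,3}.  Add the equations of all 18 pairs of
    independent edges.  An edge [i j] sees [p k] in exactly two equations, and
    likewise [q l], so the unknowns [c] cancel.  Two points [p] are
    compared six times, a [p] and a [q] are compared four times, with 18 reversals
    of [before].  What survives are the nine sums
    [before (q j) (q l) (+) before (q l) (q j) = true], one for each pair of points
    [p] and each pair of points [q]; so the total is [true] on the right and [false]
    on the left. *)
Lemma K33_parity (p q : 'I_3 -> pt) (c : 'I_3 -> 'I_3 -> pt -> bool) :
  (forall j l, j != l -> q j != q l) ->
  (forall i j, p i != q j) ->
  (forall i j k l, i != k -> j != l ->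
    c i j (p k) (+) c i j (q l) (+) c k l (p i) (+) c k l (q j) =
    before (p i) (p k) (+) before (p i) (q l)
      (+) before (q j) (p k) (+) before (q j) (q l)) -> False.
Proof.
move=> q_inj pq H.
pose o0 : 'I_3 := inord 0; pose o1 : 'I_3 := inord 1; pose o2 : 'I_3 := inord 2.
have [n01 n02 n12] : [/\ o0 != o1, o0 != o2 & o1 != o2].
  by split; rewrite -(inj_eq val_inj) /= !inordK.
have [n10 n20 n21] : [/\ o1 != o0, o2 != o0 & o2 != o1] by split; rewrite eq_sym.
pose D i j k l := c i j (p k) (+) c i j (q l) (+) c k l (p i) (+) c k l (q j)
  (+) (before (p i) (p k) (+) before (p i) (q l)
       (+) before (q j) (p k) (+) before (q j) (q l)).
have D0 i j k l : i != k -> j != l -> D i j k l = false.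
  by move=> ik jl; rewrite /D H // addbb.
pose S i k := D i o0 k o1 (+) D i o0 k o2 (+) D i o1 k o0
  (+) D i o1 k o2 (+) D i o2 k o0 (+) D i o2 k o1.
have : S o0 o1 (+) S o0 o2 (+) S o1 o2 = false by rewrite /S !D0.
suff -> : S o0 o1 (+) S o0 o2 (+) S o1 o2 = true by [].
rewrite /S /D.
have qp i j : before (q j) (p i) = ~~ before (p i) (q j).
  by rewrite before_total // eq_sym.
rewrite !qp (before_total (q_inj _ _ n10)) (before_total (q_inj _ _ n20)).
rewrite (before_total (q_inj _ _ n21)) !addbE.
btauto.
Qed.
End Polygons.

(** * Nonplanarity of K_{3,3} for continua *)

(** The form in which connectedness is used below: [P] says that a point is
    reachable from [x] by a chain of small steps, or by a continuum. *)
Lemma connected_locally_constant (T : topologicalType) (E : set T)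
    (P : T -> Prop) x :
  connected E -> E x -> P x ->
  (forall y, E y -> \forall z \near y, E z -> (P y <-> P z)) ->
  E `<=` P.
Proof.
move=> cE Ex Px locP; suff <- : E `&` P = E by move=> y [].
apply: cE.
- by exists x.
- exists (interior (~` E `|` P)); first exact: open_interior.
  rewrite predeqE => y; split=> -[Ey]; last first.
    by move=> /nbhs_singleton[].
  move=> Py; split=> //; apply: filterS (locP y Ey) => z Hz.
  by have [/Hz[H _]|] := pselect (E z); [right; exact: H|left].
- exists (~` interior (~` E `|` ~` P)); first exact/open_closedC/open_interior.
  rewrite predeqE => y; split=> -[Ey].
    by move=> Py; split=> // /nbhs_singleton[].
  move=> nPy; split=> //; apply: contrapT => Py; apply: nPy.
  apply: filterS (locP y Ey) => z Hz.
  by have [/Hz[_ H]|] := pselect (E z); [right=> /H|left].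
Qed.

Section Plane.
Variable R : realType.
Local Notation pt := (R * R)%type.
Implicit Types (a b c d u v x y z : pt) (A B E K U : set pt).

Lemma near_dist_lt z (e : R) : 0 < e -> \forall y \near z, `|z - y| < e.
Proof.
by move=> e0; apply/nbhs_normP; exists e.
Qed.

(** Edges of polygonal approximations of [E]: short jumps between points of [E],
    not required to stay in [E] in between. *)
Definition step E (e : R) : rel pt := fun a b => `[< E a /\ E b >] && (`|a - b| < e).

Lemma connected_path E (e : R) x y : connected E -> 0 < e -> E x -> E y ->
  exists2 s, path (step E e) x s & last x s = y.
Proof.
move=> cE e0 Ex; move: y.
apply: (@connected_locally_constant _ E
  (fun y => exists2 s, path (step E e) x s & last x s = y) x) => //.
  by exists [::].
move=> y Ey; apply: filterS (near_dist_lt y e0) => z yz Ez.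
have app u v : `|u - v| < e -> E u -> E v ->
  (exists2 s, path (step E e) x s & last x s = u) ->
  (exists2 s, path (step E e) x s & last x s = v).
  move=> uv Eu Ev [s ps l]; exists (rcons s v); last by rewrite last_rcons.
  by rewrite rcons_path ps /= l /step uv andbT; apply/asboolP.
by split; apply: app => //; rewrite distrC.
Qed.

Lemma seg_pointE a b t : seg_point a b t = a + t *: (b - a).
Proof.
by case: a b => [a1 a2] [b1 b2]; congr pair; rewrite /= /GRing.scale /=; ring.
Qed.

Lemma on_segment_le a b z : on_segment a b z -> `|a - z| <= `|a - b|.
Proof.
case=> t /andP[t0 t1] ->; rewrite seg_pointE opprD addrA subrr add0r.
by rewrite normrN normrZ (ger0_norm t0) distrC ler_piMl.
Qed.

Lemma continuous_seg_point a b : continuous (seg_point a b).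
Proof.
move=> t; rewrite [seg_point a b](_ : _ = fun t => a + t *: (b - a)).
  apply: cvgD; first exact: cvg_cst.
  by apply: cvgZr_tmp; exact: cvg_id.
by apply/funext => r; rewrite seg_pointE.
Qed.

Lemma on_segmentE a b : on_segment a b = seg_point a b @` `[0, 1].
Proof.
rewrite predeqE => z; split=> [[t t01 ->]|[t t01 <-]].
  by exists t => //=; rewrite in_itv.
by exists t => //; move: t01; rewrite /= in_itv.
Qed.

Lemma compact_on_segment a b : compact (on_segment a b).
Proof.
rewrite on_segmentE; apply: continuous_compact; last exact: segment_compact.
exact/continuous_subspaceT/continuous_seg_point.
Qed.

Lemma connected_on_segment a b : connected (on_segment a b).
Proof.
rewrite on_segmentE; apply: connected_continuous_connected.
  exact: segment_connected.
exact/continuous_subspaceT/continuous_seg_point.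
Qed.

(** A compact set is at positive distance from a disjoint closed set; stated
    with a filter so that finitely many such bounds combine. *)
Lemma compact_closed_dist A B : compact A -> closed B -> A `&` B = set0 ->
  \forall e \near 0^'+, forall x y, A x -> B y -> e <= `|x - y|.
Proof.
move=> /compact_near_coveringP cA clB AB.
suff : \forall e \near 0^'+, A `<=` [set x | forall y, B y -> e <= `|x - y|].
  by apply: filterS => e H x y Ax; apply: H.
apply: (cA _ _ (fun e x => forall y, B y -> e <= `|x - y|)) => x Ax.
have : nbhs x (~` B).
  apply: open_nbhs_nbhs; split; first exact: closed_openC.
  by move=> Bx; have : set0 x by rewrite -AB.
move=> /nbhs_ballP[e /= e0 xB].
have e20 : 0 < e / 2 by rewrite divr_gt0.
near=> x' e' => y By.
rewrite leNgt; apply/negP => /= x'y; apply: (xB y) => //.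
rewrite -ball_normE /=; rewrite [x - y](_ : _ = (x - x') + (x' - y)).
  apply: le_lt_trans (ler_normD _ _) _; rewrite [e]splitr; apply: ltrD.
    by near: x'; exact: near_dist_lt.
  by apply: lt_trans x'y _; near: e'; exact: nbhs_right_lt.
by rewrite addrA subrK.
Unshelve. all: by end_near. Qed.

(** K_{3,3} is not planar, even when edges are drawn as arbitrary continua that
    may overlap whenever they share a vertex.  Only independent edges have to be
    disjoint, since only those enter [K33_parity]; they are at a distance at least
    [e] from each other, so polygonal approximations with steps shorter than
    [e / 2] are still disjoint. *)
Lemma no_K33_continua (p q : 'I_3 -> pt) (E : 'I_3 -> 'I_3 -> set pt) :
  (forall i j, compact (E i j)) -> (forall i j, connected (E i j)) ->
  (forall i j, E i j (p i)) -> (forall i j, E i j (q j)) ->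
  (forall i j k l, i != k -> j != l -> E i j `&` E k l = set0) -> False.
Proof.
move=> cptE cnE Ep Eq disj.
have [e e_gt0 sep] : exists2 e : R, 0 < e & forall i j k l, i != k -> j != l ->
    forall x y, E i j x -> E k l y -> e <= `|x - y|.
  near (0 : R)^'+ => e; exists e; first by near: e; exact: nbhs_right_gt.
  near: e; do 4![apply: filter_forall => ?].
  have [->|ik] := eqVneq; first by near=> e.
  have [->|jl] := eqVneq; first by near=> e.
  apply: filterS (compact_closed_dist (cptE _ _)
    (compact_closed (@norm_hausdorff _ _) (cptE _ _)) (disj _ _ _ _ ik jl)).
  by move=> e H _ _.
have e2_gt0 : 0 < e / 2 by rewrite divr_gt0.
have s_ex i j := cid2 (connected_path (cnE i j) e2_gt0 (Ep i j) (Eq i j)).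
pose s i j := s2val (s_ex i j).
have sP i j : path (step (E i j) (e / 2)) (p i) (s i j) := s2valP (s_ex i j).
have sl i j : last (p i) (s i j) = q j := s2valP' (s_ex i j).
have step_disj i j k l : i != k -> j != l -> forall a b c d,
    step (E i j) (e / 2) a b -> step (E k l) (e / 2) c d -> segments_disjoint a b c d.
  move=> ik jl a b c d /andP[/asboolP[Ea _] ab] /andP[/asboolP[Ec _] cd] z.
  move=> /on_segment_le az /on_segment_le cz.
  have := sep _ _ _ _ ik jl _ _ Ea Ec; apply/negP; rewrite -ltNge.
  rewrite [a - c](_ : _ = (a - z) - (c - z)); last by rewrite opprB addrA subrK.
  rewrite [e]splitr; apply: le_lt_trans (ler_normB _ _) _.
  by apply: ltrD; [exact: le_lt_trans az ab|exact: le_lt_trans cz cd].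
apply: (@K33_parity _ p q (fun i j => ray_parity (p i) (s i j))).
- move=> j l jl; apply/eqP => e1.
  have : (E ord0 j `&` E ord_max l) (q j) by split; [|rewrite e1].
  by rewrite disj.
- have other (i : 'I_3) : exists k, i != k.
    by have [->|?] := eqVneq i ord0; [exists ord_max|exists ord0].
  move=> i j; apply/eqP => e1; have [k ik] := other i; have [l jl] := other j.
  have : (E i l `&` E k j) (p i) by split; [|rewrite e1].
  by rewrite disj // eq_sym.
- move=> i j k l ik jl.
  have := disjoint_polygons_parity (step_disj _ _ _ _ ik jl) (sP i j) (sP k l).
  by rewrite !sl.
Unshelve. all: by end_near. Qed.
End Plane.

(** * Outerplanar graphs contain no K_{2,3} *)

Section Access.
Variable R : realType.
Local Notation pt := (R * R)%type.
Implicit Types (x y z : pt) (D K U : set pt).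

(** Path-connection in the complement of [D], with a continuum in place of a
    path: this is the form of an edge in [no_K33_continua], and such continua are
    concatenated by taking unions. *)
Definition joined D z y := exists K,
  [/\ compact K, connected K, K z, K y & K `&` D = set0].

(** Prolong a continuum by a segment inside a ball that avoids [D]. *)
Lemma near_joined D z y : closed D -> ~ D y ->
  \forall x \near y, joined D z y <-> joined D z x.
Proof.
move=> clD Dy.
have : nbhs y (~` D) by apply: open_nbhs_nbhs; split => //; exact: closed_openC.
move=> /nbhs_ballP[e /= e0 yD]; apply: filterS (near_dist_lt y e0) => x yx.
have extend u v : on_segment u v `&` D = set0 -> joined D z u -> joined D z v.
  move=> uvD [K [cptK cnK Kz Ku KD]]; exists (K `|` on_segment u v); split.
  - by apply: compactU => //; exact: compact_on_segment.
  - apply: connectedU => //; last exact: connected_on_segment.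
    by exists u; split => //; exact: on_segmentl.
  - by left.
  - by right; exact: on_segmentr.
  - by rewrite setIUl KD uvD setU0.
have yxD : on_segment y x `&` D = set0.
  rewrite -subset0 => w [yxw Dw]; apply: (yD w) => //; rewrite -ball_normE /=.
  exact: le_lt_trans (on_segment_le yxw) yx.
split; apply: extend => //.
by rewrite -subset0 => w [/on_segmentC yxw Dw]; rewrite -yxD.
Qed.

(** [x] may lie on the frontier of the face [U], provided that the drawn arc
    through it is left out of [D].  So no accessibility of frontier points is
    required: the continuum may cross that arc before it reaches [x]. *)
Lemma closure_joined D U z x : closed D -> connected U -> U `<=` ~` D ->
  U z -> closure U x -> ~ D x -> joined D z x.
Proof.
move=> clD cnU UD Uz Ux Dx.
have [u [Uu [_]]] := Ux _ (near_joined z clD Dx); apply.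
apply: (connected_locally_constant cnU Uz _ _ Uu) => [|y Uy].
  exists [set z]; split => //; [exact: compact_set1|exact: connected1|].
  by rewrite -subset0 => w [->]; exact: UD.
by apply: filterS (near_joined z clD (UD _ Uy)).
Qed.
End Access.

Lemma adj_neq (G : sgraph) (u v : G) : adj u v -> u != v.
Proof. by apply: contraTneq => ->; rewrite adj_irrefl. Qed.

Section K23.
Variables (R : realType) (G : sgraph).
Local Notation pt := (R * R)%type.
Implicit Types (p : G -> pt) (arc : G -> G -> set pt).

Lemma is_arc_continuum (x y : pt) A : is_arc x y A ->
  [/\ compact A, connected A, A x & A y].
Proof.
case=> f [fc _ <- <- <-]; split.
- by apply: continuous_compact => //; exact: segment_compact.
- by apply: connected_continuous_connected => //; exact: segment_connected.
- by exists 0; rewrite //= in_itv /= lexx ler01.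
- by exists 1; rewrite //= in_itv /= lexx ler01.
Qed.

Lemma arcs_disjoint p arc u v u' v' : plane_embedding p arc ->
  adj u v -> adj u' v' -> u != u' -> u != v' -> v != u' -> v != v' ->
  arc u v `&` arc u' v' = set0.
Proof.
move=> [p_inj _ _ inner cross] uv uv' uu' u_v' vu' vv'.
have end_out w a b : adj a b -> w != a -> w != b -> ~ arc a b (p w).
  move=> ab wa wb abw; apply: (inner a b w ab); split => //.
  by case=> /p_inj e; [rewrite e eqxx in wa|rewrite e eqxx in wb].
rewrite -subset0 => x [x1 x2].
have [xe|xi] := pselect ([set p u; p v] x).
  by case: xe x2 => ->; apply: end_out.
have [xe|xi'] := pselect ([set p u'; p v'] x).
  by case: xe x1 => ->; apply: end_out; rewrite // eq_sym.
rewrite -(cross u v u' v') //.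
apply: contraNneq uu' => /setP/(_ u); rewrite !inE eqxx (negPf u_v') orbF.
by move=> /esym.
Qed.

(** A point [z] of the outer face serves as a third hub besides [a] and [b]: it
    is joined to [c j] by a continuum [T j] avoiding the arcs that end at the other
    two vertices [c l].  This is a drawing of K_{3,3} in the sense of
    [no_K33_continua]. *)
Lemma outerplanar_no_K23 (a b : G) (c : 'I_3 -> G) :
  outerplanar R G -> a != b -> injective c ->
  (forall j, adj a (c j)) -> (forall j, adj b (c j)) -> False.
Proof.
move=> [p [arc [emb [U [[z Dz UE] _] Up]]]] ab c_inj ac bc.
have arcP u v : adj u v -> [/\ compact (arc u v), connected (arc u v),
    arc u v (p u) & arc u v (p v)].
  by move=> uv; have [_ /(_ _ _ uv)/is_arc_continuum] := emb.
(* the arcs independent of an edge from the third hub to [c j] *)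
pose D j := \bigcup_(l in [set l | l != j]) (arc a (c l) `|` arc b (c l)).
have clD j : closed (D j).
  apply: closed_bigcup; first exact: finite_finset.
  move=> l _; have [cpt1 _ _ _] := arcP _ _ (ac l).
  have [cpt2 _ _ _] := arcP _ _ (bc l).
  by apply: closedU; apply: compact_closed => //; exact: norm_hausdorff.
have Uz : U z by rewrite UE; exact: connected_component_refl.
have UD j : U `<=` ~` D j.
  rewrite UE => w /connected_component_sub wD Dw; apply: wD; right.
  by case: Dw => l _ [Dw|Dw]; [exists a, (c l)|exists b, (c l)].
have cD j : ~ D j (p (c j)).
  have end_out w l : l != j -> adj w (c l) -> adj w (c j) -> ~ arc w (c l) (p (c j)).
    have [p_inj _ _ inner _] := emb.
    move=> lj wl wj wlj; apply: (inner _ _ (c j) wl); split => //.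
    case=> /p_inj e; first by have := adj_neq wj; rewrite e eqxx.
    by move: lj; rewrite (c_inj _ _ e) eqxx.
  by case=> l /= lj [] /end_out; apply.
have Tex j : joined (D j) z (p (c j)).
  apply: (closure_joined (clD j) _ (UD j)) => //.
  by rewrite UE; exact: component_connected.
pose T j := projT1 (cid (Tex j)).
have TP j := projT2 (cid (Tex j)).
(* hubs 0, 1, 2 are [a], [b] and the outer face *)
pose E (i j : 'I_3) : set pt :=
  match val i with 0%N => arc a (c j) | 1%N => arc b (c j) | _ => T j end.
have sub_D (i j l : 'I_3) : (i < 2)%N -> l != j -> E i l `<=` D j.
  by rewrite /E; case: i => [[|[|i]] //= _] _ lj w Ew; exists l => //; [left|right].
have disj2 (i k j l : 'I_3) : (i < 2)%N -> (2 <= k)%N -> j != l ->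
    E i j `&` E k l = set0.
  move=> i2 k2 jl; have [_ _ _ _ TD] := TP l.
  rewrite -subset0 => w [/(sub_D _ _ _ i2 jl) Dw]; rewrite -TD /E.
  by case: k k2 => [[|[|k]]].
have abj j l : j != l -> arc a (c j) `&` arc b (c l) = set0.
  move=> jl; apply: arcs_disjoint emb (ac j) (bc l) ab _ _ _.
  - exact: adj_neq.
  - by rewrite eq_sym adj_neq.
  - by rewrite (inj_eq c_inj).
pose hub (i : 'I_3) : pt :=
  match val i with 0%N => p a | 1%N => p b | _ => z end.
have EP i j : [/\ compact (E i j), connected (E i j),
    E i j (hub i) & E i j (p (c j))].
  rewrite /E /hub; case: i => [[|[|i]] i3] /=.
  - exact: arcP.
  - exact: arcP.
  - by have [] := TP j.
apply: (@no_K33_continua _ hub (fun j => p (c j)) E).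
- by move=> i j; have [] := EP i j.
- by move=> i j; have [] := EP i j.
- by move=> i j; have [] := EP i j.
- by move=> i j; have [] := EP i j.
- move=> i j k l ik jl.
  have [i2|i2] := ltnP i 2; have [k2|k2] := ltnP k 2.
  + move: ik; rewrite -(inj_eq val_inj) /E /=.
    case: i i2 => [[|[|i]] //= ?] _; case: k k2 => [[|[|k]] //= ?] _ // _.
      exact: abj.
    by rewrite setIC; apply: abj; rewrite eq_sym.
  + exact: disj2.
  + by rewrite setIC; apply: disj2; rewrite // eq_sym.
  + move: ik; rewrite -(inj_eq val_inj) /=.
    by case: i i2 => [[|[|[|i]]]] //; case: k k2 => [[|[|[|k]]]].
Qed.
End K23.

(** * Outerplanarity of the triangle *)

Section Triangle.
Variable R : realType.
Local Notation pt := (R * R)%type.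
Implicit Types (z : pt) (i j k : 'I_3).

Definition corner i : pt :=
  match val i with 0%N => (0, 0) | 1%N => (1, 0) | _ => (0, 1) end.

Definition bary k z : R :=
  match val k with 0%N => 1 - z.1 - z.2 | 1%N => z.1 | _ => z.2 end.

Lemma bary_corner k i : bary k (corner i) = (k == i)%:R.
Proof.
rewrite -(inj_eq val_inj) /bary /corner.
by case: k i => [[|[|[|k]]] ?] [[|[|[|i]]] ?] //=; rewrite ?subr0 ?subrr.
Qed.

Lemma corner_inj : injective corner.
Proof.
move=> i j /(congr1 (bary i)); rewrite !bary_corner eqxx.
by case: eqP => // _ /eqP; rewrite oner_eq0.
Qed.

Lemma bary_seg_point k a b t :
  bary k (seg_point a b t) = (1 - t) * bary k a + t * bary k b.
Proof. by rewrite /bary /seg_point; case: k => [[|[|k]] ?] /=; ring. Qed.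

(** The positive barycentric coordinates of an interior point of a side recover
    the side, which makes distinct open sides, and open sides and corners,
    disjoint. *)
Lemma bary_open_side i j z k : i != j ->
  (on_segment (corner i) (corner j) `\` [set corner i; corner j]) z ->
  (0 < bary k z) = (k == i) || (k == j).
Proof.
move=> ij [[t /andP[t0 t1] ->]] nends.
have {}t0 : 0 < t.
  rewrite lt_neqAle t0 andbT; apply: contra_notN nends => /eqP <-.
  by left; rewrite seg_pointE scale0r addr0.
have {}t1 : t < 1.
  rewrite lt_neqAle t1 andbT; apply: contra_notN nends => /eqP ->.
  by right; rewrite seg_pointE scale1r addrC subrK.
rewrite bary_seg_point !bary_corner.
have [->|ki] := eqVneq k i; first by rewrite (negPf ij) mulr1 mulr0 addr0 subr_gt0.
by case: eqVneq => _; rewrite mulr0 add0r ?mulr1 ?mulr0 ?ltxx.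
Qed.

Lemma star_connected (W : set pt) (x : pt) : W x ->
  (forall y, W y -> on_segment x y `<=` W) -> connected W.
Proof.
move=> Wx star.
have -> : W = \bigcup_(y in W) on_segment x y.
  rewrite predeqE => y; split=> [Wy|[w Ww]]; last exact: star.
  by exists y => //; exact: on_segmentr.
apply: bigcup_connected; last by move=> *; exact: connected_on_segment.
by exists x => y _; exact: on_segmentl.
Qed.

(** The drawing is part of the triangle with corners (0,0), (1,0), (0,1).  It
    lies in the closed first quadrant, whose complement is star-shaped and
    unbounded and has all three corners in its closure; the outer face contains
    this complement. *)
Lemma outerplanar_inj3 (G : sgraph) (h : G -> 'I_3) : injective h ->
  outerplanar R G.
Proof.
move=> h_inj; pose p u := corner (h u).
pose arc u v := on_segment (p u) (p v).
have neq_adj (u v : G) : adj u v -> h u != h v.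
  by rewrite (inj_eq h_inj); exact: adj_neq.
exists p, arc; split.
  split.
  - by move=> u v /corner_inj/h_inj.
  - move=> u v /neq_adj uv; exists (seg_point (p u) (p v)); split.
    + exact/continuous_subspaceT/continuous_seg_point.
    + move=> s t _ _; rewrite !seg_pointE => /addrI/eqP.
      rewrite -subr_eq0 -scalerBl scaler_eq0 subr_eq0 => /orP[/eqP//|].
      by rewrite subr_eq0 => /eqP/corner_inj/eqP; rewrite eq_sym (negPf uv).
    + by rewrite seg_pointE scale0r addr0.
    + by rewrite seg_pointE scale1r addrC subrK.
    + by rewrite /arc on_segmentE.
  - by move=> u v _; rewrite predeqE => z; split; exact: on_segmentC.
  - move=> u v w /neq_adj uv wuv.
    have side k := bary_open_side k uv wuv.
    have := side (h u); have := side (h v); rewrite !bary_corner !eqxx orbT /=.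
    have pos (b : bool) : (0 < b%:R :> R) = b by rewrite ltr0n lt0b.
    by rewrite !pos => /eqP hv /eqP hu; rewrite hu hv eqxx in uv.
  - move=> u v u' v' /neq_adj uv /neq_adj uv' /eqP ne; rewrite -subset0 => z [z1 z2].
    apply: ne; apply/setP => w; rewrite !inE -!(inj_eq h_inj).
    by rewrite -(bary_open_side _ uv z1) -(bary_open_side _ uv' z2).
pose W : set pt := [set z | z.1 < 0 \/ z.2 < 0].
have WD : W `<=` ~` drawing p arc.
  have nonneg z : drawing p arc z -> 0 <= z.1 /\ 0 <= z.2.
    have corner_ge0 i : 0 <= (corner i).1 /\ 0 <= (corner i).2.
      by case: i => [[|[|i]] ?]; rewrite /corner /= ?lexx ?ler01.
    case=> [[u _ <-]|[u [v [_ [t /andP[t0 t1] ->]]]]]; first exact: corner_ge0.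
    have [? ?] := corner_ge0 (h u); have [? ?] := corner_ge0 (h v).
    by split; rewrite addr_ge0 // mulr_ge0 // subr_ge0.
  by move=> z Wz /nonneg[]; case: Wz => ? ? ?; lra.
have Wo : W (-1, -1) by left => /=; lra.
have cW : connected W.
  apply: star_connected Wo _ => y Wy z [t /andP[t0 t1] ->].
  have [t00|t_gt0] := eqVneq t 0.
    by left; rewrite t00 /seg_point /=; lra.
  case: Wy => y0; [left|right]; rewrite /seg_point /=; nra.
have WU : W `<=` connected_component (~` drawing p arc) (-1, -1).
  exact: connected_component_max.
exists (connected_component (~` drawing p arc) (-1, -1)).
  split; first by exists (-1, -1) => //; exact: WD.
  move=> [M [_ /(_ (`|M| + 1))]].
  rewrite (le_lt_trans (ler_norm M)) ?ltrDl // => /(_ isT).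
  have Wx : W (- (`|M| + 2), 0) by left => /=; have := normr_ge0 M; lra.
  move=> /(_ _ (WU _ Wx)) /=; rewrite prod_normE /= normrN ge_max => /andP[+ _].
  by rewrite ger0_norm; have := normr_ge0 M; lra.
move=> u; apply: (closure_subset WU).
move=> B /nbhs_ballP[e /= e0 uB].
exists (p u - (e / 2, e / 2)); split.
  rewrite /p /corner; case: (h u) => [[|[|i]] ?]; [left|right|left] => /=; lra.
apply: uB; rewrite -ball_normE /= opprB addrC subrK prod_normE /= maxxx ger0_norm; lra.
Qed.
End Triangle.

(** * Noncommuting graphs without K_{2,3} *)

Lemma graph_iso_complete (G : sgraph) n : #|G| = n ->
  (forall u v : G, u != v -> adj u v) -> graph_iso G (complete_graph n).
Proof.
move=> Gn full; exists (cast_ord Gn \o enum_rank).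
  exists (enum_val \o cast_ord (esym Gn)) => u /=.
    by rewrite cast_ordK enum_rankK.
  by rewrite enum_valK cast_ordKV.
move=> u v; rewrite [LHS]/adj /= /complete_adj /= (inj_eq (@cast_ord_inj _ _ _)).
rewrite (inj_eq enum_rank_inj); apply/idP/idP; first exact: full.
exact: adj_neq.
Qed.

Lemma neq_addr (V : zmodType) (x y : V) : y != 0 -> x != x + y.
Proof. by rewrite -{1}[x]addr0 (inj_eq (addrI x)) eq_sym. Qed.

Section LieBracket.
Variables (F : fieldType) (L : lieAlgType F).
Implicit Types x y z : L.

Lemma lieDl x y z : lie (x + y) z = lie x z + lie y z.
Proof. by have := lie_linearl z 1 x y; rewrite !scale1r. Qed.

Lemma lieDr x y z : lie x (y + z) = lie x y + lie x z.
Proof. by have := lie_linearr x 1 y z; rewrite !scale1r. Qed.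

Lemma lie0l x : lie 0 x = 0.
Proof. by apply: (addrI (lie 0 x)); rewrite -lieDl !addr0. Qed.

Lemma lieZl k x y : lie (k *: x) y = k *: lie x y.
Proof. by have := lie_linearl y k x 0; rewrite addr0 lie0l addr0. Qed.
End LieBracket.

Section Outerplanar.
Variables (R : realType) (F : finFieldType) (L : finDimLieAlgType F).
Implicit Types x y z u v w s t : L.
Local Notation G := (noncommuting_graph L).

Definition central x := (x : finvect_type L) \in lie_center L.

Lemma noncentralP x : reflect (exists y, lie x y != 0) (~~ central x).
Proof.
rewrite /central inE negb_forall.
by apply: (iffP existsP) => -[y xy]; exists y.
Qed.

Lemma noncentral_lie x y : lie x y != 0 -> ~~ central x.
Proof. by move=> xy; apply/noncentralP; exists y. Qed.

Lemma lie_neq0C x y : (lie x y != 0) = (lie y x != 0).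
Proof. by rewrite lie_anticomm oppr_eq0. Qed.

Lemma noncommuting_triangle_uniq x y : lie x y != 0 -> uniq [:: x; y; x + y].
Proof.
move=> xy; have x0 : x != 0 by apply: contraNneq xy => ->; rewrite lie0l.
have y0 : y != 0.
  by apply: contraNneq xy => ->; rewrite lie_anticomm lie0l oppr0.
rewrite /= !inE negb_or neq_addr //= andbT [x + y]addrC neq_addr // !andbT.
by apply: contraNneq xy => ->; rewrite liexx.
Qed.

Hypothesis outerG : outerplanar R G.

Lemma no_lie_K23 u v (t : 'I_3 -> L) : u != v -> injective t ->
  (forall j, lie u (t j) != 0) -> (forall j, lie v (t j) != 0) -> False.
Proof.
move=> uv t_inj ut vt.
pose vtx x (nx : ~~ central x) : G := exist _ (x : finvect_type L) nx.
have nt j : ~~ central (t j).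
  by apply: noncentral_lie (u) _; rewrite lie_neq0C.
have lie_adj x y nx ny : lie x y != 0 -> adj (@vtx x nx) (@vtx y ny).
  move=> xy; rewrite /= /noncommuting xy andbT.
  by apply: contraNneq xy => /(congr1 val) /= ->; rewrite liexx.
apply: (@outerplanar_no_K23 R G (vtx u (noncentral_lie (ut ord0)))
  (vtx v (noncentral_lie (vt ord0))) (fun j => vtx (t j) (nt j))) => //.
- by move=> i j /(congr1 val)/t_inj.
- by move=> j; exact: lie_adj.
- by move=> j; exact: lie_adj.
Qed.

Lemma no_lie_K23_seq u v t0 t1 t2 : u != v -> uniq [:: t0; t1; t2] ->
  {in [:: t0; t1; t2], forall t, lie u t != 0} ->
  {in [:: t0; t1; t2], forall t, lie v t != 0} -> False.
Proof.
move=> uv ut u_t v_t.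
apply: (@no_lie_K23 u v (fun j => nth 0 [:: t0; t1; t2] j)) => //.
- by move=> i j /eqP; rewrite nth_uniq // => /eqP/val_inj.
- by move=> j; apply: u_t; rewrite mem_nth.
- by move=> j; apply: v_t; rewrite mem_nth.
Qed.

(** Commuting elements with a common neighbour [t] have the three common
    neighbours [t], [t + u] and [t + v]. *)
Lemma no_common_neighbor u v t : u != v -> lie u v = 0 ->
  lie u t != 0 -> lie v t != 0 -> False.
Proof.
move=> uv uv0 ut vt.
have vu0 : lie v u = 0 by rewrite lie_anticomm uv0 oppr0.
have u0 : u != 0 by apply: contraNneq ut => ->; rewrite lie0l.
have v0 : v != 0 by apply: contraNneq vt => ->; rewrite lie0l.
apply: (@no_lie_K23_seq u v t (t + u) (t + v)) => //.
- by rewrite /= !inE negb_or (inj_eq (addrI t)) uv !neq_addr.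
- by move=> s; rewrite !inE => /or3P[]/eqP ->; rewrite ?lieDr ?liexx ?uv0 ?addr0.
- by move=> s; rewrite !inE => /or3P[]/eqP ->; rewrite ?lieDr ?liexx ?vu0 ?addr0.
Qed.

(** The centralizers of [u] and [v] are proper subgroups, and a group is not the
    union of two proper subgroups, so some [t] commutes with neither; if [u] and [v]
    commuted, this [t] would be excluded by [no_common_neighbor]. *)
Lemma noncentral_lie_neq0 u v : ~~ central u -> ~~ central v -> u != v ->
  lie u v != 0.
Proof.
move=> /noncentralP[s us] /noncentralP[t vt] uv; apply/eqP => uv0.
have [vs|] := eqVneq (lie v s) 0; last exact: no_common_neighbor uv uv0 us.
have [ut|ut] := eqVneq (lie u t) 0; last exact: no_common_neighbor uv uv0 ut vt.
by apply: (@no_common_neighbor u v (s + t)); rewrite // lieDr ?ut ?vs ?addr0 ?add0r.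
Qed.

(** [k *: x] commutes with [x], so it has to be [x]: the field has two
    elements. *)
Lemma scalar_01 (k : F) x : ~~ central x -> k != 0 -> k = 1.
Proof.
move=> nx k0; have [y xy] := noncentralP _ nx; apply/eqP/negPn/negP => k1.
have kxy : lie (k *: x) y != 0 by rewrite lieZl scaler_eq0 negb_or k0.
have x0 : x != 0 by apply: contraNneq xy => ->; rewrite lie0l.
have /eqP[] : lie (k *: x) x != 0.
  apply: noncentral_lie_neq0 => //; first exact: noncentral_lie kxy.
  by rewrite -subr_eq0 -{2}[x]scale1r -scalerBl scaler_eq0 subr_eq0 negb_or k1.
by rewrite lieZl liexx scaler0.
Qed.

Lemma no_five_noncentral a b c d e : uniq [:: a; b; c; d; e] ->
  all (fun x => ~~ central x) [:: a; b; c; d; e] -> False.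
Proof.
rewrite /= !inE !negb_or -!andbA.
case/and5P=> ab ac ad ae /and5P[bc bd be cd /and3P[ce de _]].
case/and5P=> na nb nc nd /andP[ne _].
apply: (@no_lie_K23_seq a b c d e) => //.
- by rewrite /= !inE negb_or cd ce de.
- by move=> s; rewrite !inE => /or3P[]/eqP ->; exact: noncentral_lie_neq0.
- by move=> s; rewrite !inE => /or3P[]/eqP ->; exact: noncentral_lie_neq0.
Qed.

(** A further noncentral [w] would bring [w + x] along, and five vertices of a
    complete graph contain a K_{2,3}. *)
Lemma noncentral_in x y w : lie x y != 0 -> ~~ central w ->
  w \in [:: x; y; x + y].
Proof.
move=> xy nw.
have yx : lie y x != 0 by rewrite lie_neq0C.
have [nx ny] := (noncentral_lie xy, noncentral_lie yx).
have opp z : - z = z.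
  have N1 : -1 = 1 :> F by apply: (scalar_01 nx); rewrite oppr_eq0 oner_eq0.
  by rewrite -scaleN1r N1 scale1r.
have nzero z : ~~ central z -> z != 0.
  by move=> /noncentralP[s]; apply: contraNneq => ->; rewrite lie0l.
apply/negPn/negP; rewrite !inE !negb_or => /and3P[wx wy wxy].
have nxy : ~~ central (x + y).
  by apply: noncentral_lie (y) _; rewrite lieDl liexx addr0.
have nwx : ~~ central (w + x).
  apply: noncentral_lie (x) _; rewrite lieDl liexx addr0.
  exact: noncentral_lie_neq0.
apply: (@no_five_noncentral x y (x + y) w (w + x)); last by rewrite /= nx ny nxy nw nwx.
have w_out : w \notin [:: x; y; x + y] by rewrite !inE !negb_or wx wy.
have wx_out : w + x \notin [:: x; y; x + y].
  rewrite !inE !negb_or; apply/and3P; split.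
  - by rewrite addrC eq_sym neq_addr ?nzero.
  - by apply: contraNneq wxy => <-; rewrite addrCA -{2}[x]opp subrr addr0.
  - by rewrite addrC (inj_eq (addrI x)).
rewrite -[[:: _; _; _; _; _]]/([:: x; y; x + y] ++ [:: w; w + x]) cat_uniq.
apply/and3P; split; first exact: noncommuting_triangle_uniq.
  by apply/hasPn => z; rewrite mem_seq2 => /orP[]/eqP ->.
by rewrite /= inE neq_addr ?nzero.
Qed.

Lemma iso_K3 x y : lie x y != 0 -> graph_iso G (complete_graph 3).
Proof.
move=> xy.
have yx : lie y x != 0 by rewrite lie_neq0C.
have [nx ny] := (noncentral_lie xy, noncentral_lie yx).
have nxy : ~~ central (x + y).
  by apply: noncentral_lie (y) _; rewrite lieDl liexx addr0.
apply: graph_iso_complete.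
  pose vtx z (nz : ~~ central z) : G := exist _ (z : finvect_type L) nz.
  pose V := [:: vtx x nx; vtx y ny; vtx (x + y) nxy].
  have <- : size V = 3%N by [].
  have V_uniq : uniq V.
    by rewrite -(map_inj_uniq val_inj); exact: noncommuting_triangle_uniq.
  rewrite -(card_uniqP V_uniq); apply: eq_card => -[w nw].
  have := noncentral_in xy nw.
  by rewrite !inE -!val_eqE.
move=> u v uv; rewrite /= /noncommuting uv /=.
exact: noncentral_lie_neq0 (valP u) (valP v) uv.
Qed.
End Outerplanar.

Theorem theorem3p7 (R : realType) (F : finFieldType) (L : finDimLieAlgType F)
    (L_nonabelian : ~ lie_abelian L) :
  outerplanar R (noncommuting_graph L) <->
  graph_iso (noncommuting_graph L) (complete_graph 3).
Proof.
split=> [outerG|[h /bij_inj h_inj _]]; last exact: (@outerplanar_inj3 R _ h).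
have [x [y xy]] : exists x y : L, lie x y != 0.
  apply: contrapT => nxy; apply: L_nonabelian => x y.
  by apply/eqP/negPn/negP => xy; apply: nxy; exists x, y.
exact (iso_K3 outerG xy).
Qed.
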